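(* Let $f:\mathbb{Z}_3\to\mathbb{Z}_3$ be a polynomial map defined by $f(x)=a_dx^d+a_{d-1}x^{d-1}+\cdots+a_1x+a_0$ with coefficients in $\mathbb{Z}_3$. Set $a_i=0$ for $i>d$, and $$A'_0=\sum_{i\geq 2,\ i\text{ even}}a_ia_0^{i-1},\quad A'_1=\sum_{i\geq 1,\ i\text{ odd}}a_ia_0^{i-1},\quad D'_0=\sum_{i\geq 2,\ i\text{ even}}i\,a_ia_0^{i-1},\quad D'_1=\sum_{i\geq 1,\ i\text{ odd}}i\,a_ia_0^{i-1}.$$ Then the dynamical system $(\mathbb{Z}_3,f)$ is minimal if and only if $A'_0\in 3\mathbb{Z}_3$, $A'_1\in 1+3\mathbb{Z}_3$, and $f$ fulfils one of the following conditions (1), (2), (3) or (4): (1) $D'_0\equiv 0\ [3]$, $D'_1\equiv 2\ [3]$, $a_1\equiv 1\ [3]$, $A'_1+5\not\equiv 0\ [9]$ and $A'_1+5\not\equiv 3a_2a_0+3\sum_{j\geq 0}a_{5+6j}a_0^{4+6j}\ [9]$; (2) $D'_0\equiv 0\ [3]$, $D'_1\equiv 1\ [3]$, $a_1\equiv 1\ [3]$, $A'_0+6\not\equiv 0\ [9]$ and $A'_0+6\not\equiv 6a_2a_0+3\sum_{j\geq 0}a_{2+6j}a_0^{1+6j}\ [9]$; (3) $D'_0\equiv 1\ [3]$, $D'_1\equiv 0\ [3]$, $a_1\equiv 2\ [3]$, $A'_1+5\not\equiv 0\ [9]$ and $A'_1+5\not\equiv 6a_2a_0+3\sum_{j\geq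 0}a_{5+6j}a_0^{4+6j}\ [9]$; (4) $D'_0\equiv 2\ [3]$, $D'_1\equiv 0\ [3]$, $a_1\equiv 2\ [3]$, $A'_0+6\not\equiv 0\ [9]$ and $A'_0+6\not\equiv 3a_2a_0+3\sum_{j\geq 0}a_{2+6j}a_0^{1+6j}\ [9]$.
   Context: $\mathbb{Z}_3$ is the ring of 3-adic integers with its usual (3-adic) topology. For $x,y\in\mathbb{Z}_3$ and $m\in\{3,9\}$, $x\equiv y\ [m]$ means $x-y\in m\mathbb{Z}_3$. The dynamical system $(\mathbb{Z}_3,f)$ is minimal if every orbit $\{f^n(x): n\geq 0\}$, $x\in\mathbb{Z}_3$, is dense in $\mathbb{Z}_3$, where $f^n$ is the $n$-fold composition.
   Formalization: The condition a_0 ∉ 3Z_3 is added to the right-hand side of the equivalence; without it the claim fails, e.g. f(x)=x satisfies A'_0∈3Z_3, A'_1∈1+3Z_3 and condition (2) but is not minimal. *)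

(* Defs.v *)
(* MathComp world, with the topology of MathComp-Analysis. *)
From HB Require Import structures.
From mathcomp Require Import all_boot all_order all_algebra.
From mathcomp Require Import boolp classical_sets topology.

Set Implicit Arguments.
Unset Strict Implicit.
Unset Printing Implicit Defensive.

Import GRing.Theory.
Local Open Scope classical_set_scope.
Local Open Scope ring_scope.

(* Z_3 as the inverse limit of the rings Z/3^n: the n-th component is the
   representative in {0, ..., 3^n - 1}; the compatibility condition also
   forces residue n < 3 ^ n. *)
Record Z3 : Type := MkZ3 {
  residue : nat -> nat;
  residue_compat : forall n, (residue n = residue n.+1 %% 3 ^ n)%N
}.

HB.instance Definition _ := gen_eqMixin Z3.
HB.instance Definition _ := gen_choiceMixin Z3.

Section Z3Ring.
Local Open Scope nat_scope.

Lemma Z3_ext (x y : Z3) : (forall n, residue x n = residue y n) -> x = y.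
Proof.
case: x y => [f hf] [g hg] /= fg.
have {}fg : f = g by apply: funext.
by subst g; rewrite (Prop_irrelevance hf hg).
Qed.

Lemma residue_mod (x : Z3) n : residue x n %% 3 ^ n = residue x n.
Proof. by rewrite residue_compat modn_mod. Qed.

Lemma residueS (x : Z3) n : residue x n.+1 = residue x n %[mod 3 ^ n].
Proof. by rewrite residue_mod -residue_compat. Qed.

Lemma residue_le (x : Z3) n : residue x n <= 3 ^ n.
Proof. by rewrite -residue_mod ltnW // ltn_mod expn_gt0. Qed.

Lemma coherent_compat (g : nat -> nat) :
    (forall n, g n.+1 = g n %[mod 3 ^ n]) ->
  forall n, g n %% 3 ^ n = (g n.+1 %% 3 ^ n.+1) %% 3 ^ n.
Proof. by move=> gS n; rewrite modn_dvdm ?gS // dvdn_exp2l. Qed.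

Definition Z3_of_coherent (g : nat -> nat)
    (gS : forall n, g n.+1 = g n %[mod 3 ^ n]) : Z3 :=
  MkZ3 (coherent_compat gS).

Lemma add_coherent (x y : Z3) n :
  residue x n.+1 + residue y n.+1 = residue x n + residue y n %[mod 3 ^ n].
Proof. by rewrite -modnDm !residueS modnDm. Qed.

Lemma mul_coherent (x y : Z3) n :
  residue x n.+1 * residue y n.+1 = residue x n * residue y n %[mod 3 ^ n].
Proof. by rewrite -modnMm !residueS modnMm. Qed.

Lemma opp_coherent (x : Z3) n :
  3 ^ n.+1 - residue x n.+1 = 3 ^ n - residue x n %[mod 3 ^ n].
Proof.
apply/eqP; rewrite -(eqn_modDr (residue x n)) subnK ?residue_le // modnn.
by rewrite -modnDmr -residueS modnDmr subnK ?residue_le // expnS modnMl.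
Qed.

Definition Z3_zero : Z3 := @Z3_of_coherent (fun=> 0) (fun=> erefl).
Definition Z3_one : Z3 := @Z3_of_coherent (fun=> 1) (fun=> erefl).
Definition Z3_add (x y : Z3) : Z3 := Z3_of_coherent (add_coherent x y).
Definition Z3_mul (x y : Z3) : Z3 := Z3_of_coherent (mul_coherent x y).
Definition Z3_opp (x : Z3) : Z3 := Z3_of_coherent (opp_coherent x).

Lemma Z3_addA : associative Z3_add.
Proof. by move=> x y z; apply: Z3_ext => n /=; rewrite modnDml modnDmr addnA. Qed.

Lemma Z3_addC : commutative Z3_add.
Proof. by move=> x y; apply: Z3_ext => n /=; rewrite addnC. Qed.

Lemma Z3_add0 : left_id Z3_zero Z3_add.
Proof. by move=> x; apply: Z3_ext => n /=; rewrite mod0n residue_mod. Qed.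

Lemma Z3_addN : left_inverse Z3_zero Z3_opp Z3_add.
Proof.
move=> x; apply: Z3_ext => n /=.
by rewrite modnDml subnK ?residue_le // modnn mod0n.
Qed.

Lemma Z3_mulA : associative Z3_mul.
Proof. by move=> x y z; apply: Z3_ext => n /=; rewrite modnMml modnMmr mulnA. Qed.

Lemma Z3_mulC : commutative Z3_mul.
Proof. by move=> x y; apply: Z3_ext => n /=; rewrite mulnC. Qed.

Lemma Z3_mul1 : left_id Z3_one Z3_mul.
Proof. by move=> x; apply: Z3_ext => n /=; rewrite modnMml mul1n residue_mod. Qed.

Lemma Z3_mulD : left_distributive Z3_mul Z3_add.
Proof.
by move=> x y z; apply: Z3_ext => n /=; rewrite modnMml modnDml modnDmr mulnDl.
Qed.

Lemma Z3_one_neq0 : Z3_one != Z3_zero.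
Proof. by apply/eqP => /(congr1 (residue^~ 1)). Qed.

End Z3Ring.

HB.instance Definition _ :=
  GRing.isZmodule.Build Z3 Z3_addA Z3_addC Z3_add0 Z3_addN.
HB.instance Definition _ :=
  GRing.Zmodule_isComNzRing.Build Z3
    Z3_mulA Z3_mulC Z3_mul1 Z3_mulD Z3_one_neq0.

Definition Z3_multiples (m : nat) : set Z3 := [set m%:R * z | z in setT].

Definition Z3_eqmod (m : nat) (x y : Z3) : Prop := Z3_multiples m (x - y).

Notation "x ≡ y [mod m ]" := (Z3_eqmod m x y)
  (at level 70, y at next level, format "x  ≡  y  [mod  m ]") : ring_scope.

(* 3-adic topology: the cosets x + 3^n Z_3 form a neighbourhood base at x. *)
Definition Z3_open : set (set Z3) :=
  [set O | forall x, O x ->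
    exists n, forall y, y ≡ x [mod 3 ^ n] -> O y].

Lemma Z3_multiples_exp (m n : nat) :
  (m <= n)%N -> Z3_multiples (3 ^ n) `<=` Z3_multiples (3 ^ m).
Proof.
move=> mn _ [z _ <-]; exists ((3 ^ (n - m))%:R * z) => //.
by rewrite mulrA -natrM -expnD subnKC.
Qed.

Lemma Z3_openT : Z3_open setT.
Proof. by move=> x _; exists 0%N. Qed.

Lemma Z3_openI : setI_closed Z3_open.
Proof.
move=> A B oA oB x [Ax Bx].
have [m Am] := oA x Ax; have [n Bn] := oB x Bx.
exists (maxn m n) => y xy; split.
  by apply: Am; apply: Z3_multiples_exp xy; rewrite leq_maxl.
by apply: Bn; apply: Z3_multiples_exp xy; rewrite leq_maxr.
Qed.

Lemma Z3_open_bigU (I : Type) (F : I -> set Z3) :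
  (forall i, Z3_open (F i)) -> Z3_open (\bigcup_i F i).
Proof.
move=> oF x [i _ Fx]; have [n Fn] := oF i x Fx.
by exists n => y xy; exists i => //; apply: Fn.
Qed.

HB.instance Definition _ :=
  isOpenTopological.Build Z3 Z3_openT Z3_openI Z3_open_bigU.

Definition minimal_system (T : topologicalType) (f : T -> T) : Prop :=
  forall x : T, dense [set iter n f x | n in [set: nat]].

(* For p = a_d X^d + ... + a_0 we have a_i = p`_i, which is 0 for i >= size p,
   so truncating the sums below at size p loses no nonzero term.
   When a_0 is a unit, the a_i a_0^(i-1) are the coefficients of the conjugate
   a_0^-1 f(a_0 x), whose constant term is 1.  When 3 | a_0 the congruences on
   these sums no longer detect minimality (for f(x) = x one gets A'_0 = D'_0 = 0
   and A'_1 = D'_1 = a_1 = 1, as for a minimal system), so a criterion in terms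
   of them has to require a_0 \notin 3 Z_3 separately. *)
Section Coefficients.
Variable p : {poly Z3}.

Definition coefA'0 : Z3 :=
  \sum_(2 <= i < size p | ~~ odd i) p`_i * p`_0 ^+ i.-1.
Definition coefA'1 : Z3 :=
  \sum_(1 <= i < size p | odd i) p`_i * p`_0 ^+ i.-1.
Definition coefD'0 : Z3 :=
  \sum_(2 <= i < size p | ~~ odd i) i%:R * p`_i * p`_0 ^+ i.-1.
Definition coefD'1 : Z3 :=
  \sum_(1 <= i < size p | odd i) i%:R * p`_i * p`_0 ^+ i.-1.

Definition coefS5 : Z3 :=
  \sum_(0 <= j < size p) p`_(5 + 6 * j) * p`_0 ^+ (4 + 6 * j).
Definition coefS2 : Z3 :=
  \sum_(0 <= j < size p) p`_(2 + 6 * j) * p`_0 ^+ (1 + 6 * j).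

End Coefficients.

(* Main.v *)
From HB Require Import structures.
Require Import Defs.
From mathcomp Require Import all_boot all_order all_algebra.
From mathcomp Require Import boolp classical_sets topology.
From mathcomp Require Import ring zify.

Import GRing.Theory.
Local Open Scope ring_scope.

(* A 1-Lipschitz map f is minimal iff for every n the orbit of 0 modulo 3^n is a
   single cycle of length 3^n; since the period of 0 is then a power of 3, this
   says that f^(3^n)(0) has valuation exactly n for every n.

   Let g = f o f o f, with g(0) = 3b, and let a, c be the coefficients of X and
   X^2 in g.  Then g(g(g(0))) = 3b(1 + a + a^2) + 9cb^2(a + (1 + a)^2) mod 27,
   so that, when 3 does not divide b, the levels n = 1, 2 amount to a = 1 and
   cb <> 1 mod 3.  From level 2 on nothing can fail: if P(0) = 3^n u with u a
   unit, n >= 2 and P'(0) = 1 mod 3, then P(P(P(0))) = 3^(n+1) u' with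
   u' = u mod 3, and (P o P o P)'(0) = 1 mod 3.

   Finally f(a_0 x) = a_0 q(x) where q has constant term 1 and coefficients
   a_i a_0^(i-1); modulo 3 the cycle of q has to be 0 -> 1 -> -1 -> 0, and the
   values of q, q', q'' at 1 and -1 express b, a, c through A', D' and S. *)

(** * Congruences in Z_3 *)

Lemma Z3_eqmodP (m : nat) (x y : Z3) :
  x ≡ y [mod m] <-> exists z, x = y + m%:R * z.
Proof.
split=> [[z _ zE]|[z ->]]; first by exists z; rewrite zE addrC subrK.
by exists z => //; ring.
Qed.

Lemma Z3_eqmod0P (m : nat) (x : Z3) :
  x ≡ 0 [mod m] <-> exists z, x = m%:R * z.
Proof. by rewrite Z3_eqmodP; split=> -[z ->]; exists z; rewrite add0r. Qed.

Lemma residueD (x y : Z3) n :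
  residue (x + y) n = ((residue x n + residue y n) %% 3 ^ n)%N.
Proof. by []. Qed.

Lemma residueM (x y : Z3) n :
  residue (x * y) n = ((residue x n * residue y n) %% 3 ^ n)%N.
Proof. by []. Qed.

Lemma residue_nat m n : residue m%:R n = (m %% 3 ^ n)%N.
Proof.
elim: m => [|m IHm]; first by [].
by rewrite -addn1 natrD /= IHm modnDml modnDmr.
Qed.

Lemma residue_lt (x : Z3) n : (residue x n < 3 ^ n)%N.
Proof. by rewrite -residue_mod ltn_mod expn_gt0. Qed.

Lemma residue_trunc (x : Z3) m n :
  residue x m = (residue x (m + n) %% 3 ^ m)%N.
Proof.
elim: n => [|n IHn]; first by rewrite addn0 residue_mod.
rewrite IHn addnS residue_compat modn_dvdm //.
by rewrite dvdn_exp2l // leq_addr.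
Qed.

Lemma residue_eq0 (x : Z3) n :
  residue x n = 0%N <-> x ≡ 0 [mod 3 ^ n].
Proof.
rewrite Z3_eqmod0P; split=> [x0|[z ->]]; last first.
  by rewrite /= residue_nat modnn mul0n mod0n.
have dvd k : (3 ^ n %| residue x (n + k))%N.
  by rewrite /dvdn -residue_trunc x0.
(* Dividing by 3^n costs n digits, so the k-th component of the quotient is read off at level n + k
   of [x]. *)
have gS k : (residue x (n + k.+1) %/ 3 ^ n =
             residue x (n + k) %/ 3 ^ n %[mod 3 ^ k])%N.
  apply/eqP; rewrite -(eqn_pmul2r (_ : 0 < 3 ^ n))%N ?expn_gt0 //.
  rewrite !muln_modl // !divnK // -expnD (addnC k) addnS.
  by rewrite residueS.
exists (Z3_of_coherent gS); apply: Z3_ext => k /=.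
rewrite residue_nat modnMml modnMmr mulnC divnK //.
by rewrite addnC -residue_trunc.
Qed.

Lemma eqmod_residue (x y : Z3) n :
  x ≡ y [mod 3 ^ n] <-> residue x n = residue y n.
Proof.
have -> : x ≡ y [mod 3 ^ n] <-> x - y ≡ 0 [mod 3 ^ n].
  by rewrite /Z3_eqmod subr0.
rewrite -residue_eq0; split=> [xy0|xy].
  by rewrite -[x in LHS](subrK y) residueD xy0 add0n residue_mod.
rewrite /= xy modnDmr subnKC ?modnn //; exact: residue_le.
Qed.

Lemma eqmod_refl m (x : Z3) : x ≡ x [mod m].
Proof. by apply/Z3_eqmodP; exists 0; rewrite mulr0 addr0. Qed.

Lemma eqmod_sym m (x y : Z3) : x ≡ y [mod m] -> y ≡ x [mod m].
Proof. by move=> /Z3_eqmodP[z ->]; apply/Z3_eqmodP; exists (- z); ring. Qed.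

Lemma eqmod_trans m (y x z : Z3) :
  x ≡ y [mod m] -> y ≡ z [mod m] -> x ≡ z [mod m].
Proof.
move=> /Z3_eqmodP[u ->] /Z3_eqmodP[v ->]; apply/Z3_eqmodP; exists (u + v); ring.
Qed.

Lemma eqmod_horner m (p : {poly Z3}) (x y : Z3) :
  x ≡ y [mod m] -> p.[x] ≡ p.[y] [mod m].
Proof.
move=> /Z3_eqmodP[z xE]; elim/poly_ind: p => [|p c /Z3_eqmodP[w pE]].
  by rewrite !horner0; exact: eqmod_refl.
rewrite !hornerMXaddC; apply/Z3_eqmodP; rewrite pE xE.
exists (p.[y] * z + w * y + m%:R * w * z); ring.
Qed.

(** Z_3 has no 3-torsion: if 3^n x = 0, component n + k of this product shows that 3^k divides
    [residue x (n + k)], so component k of x is 0. *)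
Lemma pow3_mulI n : injective ( *%R (3 ^ n)%:R : Z3 -> Z3).
Proof.
move=> x y xy; apply/subr0_eq.
have {xy} : (3 ^ n)%:R * (x - y) = 0 :> Z3 by rewrite mulrBr xy subrr.
move: (x - y) => {x y} x x0; apply: Z3_ext => k /=.
rewrite mod0n (residue_trunc x k n) addnC.
move/(congr1 (fun z => residue z (n + k))): x0 => /=.
rewrite residue_nat modnMml mod0n => /eqP.
rewrite expnD -muln_modr muln_eq0 expn_eq0 /= => /eqP.
by rewrite addnC.
Qed.

Lemma eqmod_pow3_mull m n (x : Z3) :
  (3 ^ m)%:R * x ≡ 0 [mod 3 ^ (m + n)] <-> x ≡ 0 [mod 3 ^ n].
Proof.
rewrite !Z3_eqmod0P; split=> [[z]|[z ->]].
  by rewrite expnD natrM -mulrA => /pow3_mulI ->; exists z.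
by exists z; rewrite expnD natrM mulrA.
Qed.

Lemma eqmod_unit_mull n (a x : Z3) : ~ a ≡ 0 [mod 3] ->
  a * x ≡ 0 [mod 3 ^ n] <-> x ≡ 0 [mod 3 ^ n].
Proof.
move=> a0; split=> [|/Z3_eqmod0P[z ->]]; last first.
  by apply/Z3_eqmod0P; exists (a * z); ring.
case: n => [|n].
  by move=> _; apply/Z3_eqmod0P; exists x; rewrite expn0 mul1r.
rewrite -!residue_eq0 residueM => /eqP; rewrite -/(dvdn _ _) Gauss_dvdr.
  by rewrite /dvdn residue_mod => /eqP.
rewrite coprimeXl // prime_coprime //; apply/negP => a3; apply: a0.
apply/(residue_eq0 _ 1).
by rewrite (residue_trunc a 1 n) add1n; apply/eqP.
Qed.

(** Reduction modulo 3 lands in a finite ring that computes, so residual identities can be settled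
    by enumeration. *)
Definition red3 (x : Z3) : 'Z_3 := (residue x 1)%:R.

Lemma mod3_natr k : (k %% 3)%:R = k%:R :> 'Z_3.
Proof. by apply: val_inj; rewrite /= !val_Zp_nat // modn_mod. Qed.

Lemma red3_is_zmod_morphism : zmod_morphism red3.
Proof.
move=> x y; apply/eqP; rewrite eq_sym subr_eq -natrD.
by rewrite /red3 -[in X in X == _](subrK y x) residueD mod3_natr.
Qed.

Lemma red3_is_monoid_morphism : monoid_morphism red3.
Proof. by split=> // x y; rewrite /red3 residueM mod3_natr natrM. Qed.

HB.instance Definition _ :=
  GRing.isZmodMorphism.Build Z3 'Z_3 red3 red3_is_zmod_morphism.
HB.instance Definition _ :=
  GRing.isMonoidMorphism.Build Z3 'Z_3 red3 red3_is_monoid_morphism.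

Lemma red3_eq0 (x : Z3) : x ≡ 0 [mod 3] <-> red3 x = 0.
Proof.
rewrite -(residue_eq0 x 1); split; first by rewrite /red3 => ->.
move/(congr1 val); rewrite /= val_Zp_nat //.
by rewrite -[in X in _ -> X](residue_mod x 1).
Qed.

Lemma red3_eq (x y : Z3) : x ≡ y [mod 3] <-> red3 x = red3 y.
Proof.
have -> : x ≡ y [mod 3] <-> x - y ≡ 0 [mod 3] by rewrite /Z3_eqmod subr0.
rewrite red3_eq0 rmorphB /=; split; first exact: subr0_eq.
by move=> ->; rewrite subrr.
Qed.

(** * Minimality and the orbit of 0 *)

Lemma iter_mul_fix (T : Type) (f : T -> T) x k m :
  iter k f x = x -> iter (m * k) f x = x.
Proof.
by move=> fx; elim: m => //= m IHm; rewrite mulSn iterD IHm.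
Qed.

Lemma transitive_order (T : finType) (f : T -> T) (x0 : T) :
  (forall x y, exists k, iter k f x = y) ->
  iter #|T| f x0 = x0 /\ forall k, (0 < k < #|T|)%N -> iter k f x0 <> x0.
Proof.
move=> ftr.
have ex_pre y : exists x, f x == y.
  (* Starting from [f y] guarantees at least one application of [f] on the way to [y], hence a
     preimage of [y]. *)
  by have [k] := ftr (f y) y; rewrite -iterSr iterS => <-; exists (iter k f y).
pose g y := xchoose (ex_pre y).
have gK : cancel g f by move=> y; apply/eqP/(xchooseP (ex_pre y)).
have f_inj : injective f by apply/can_inj/canF_sym/gK.
split.
  rewrite -[in LHS](_ : fingraph.order f x0 = #|T|) ?iter_order //.
  apply: eq_card => y; rewrite !inE; have [k <-] := ftr x0 y.
  exact: fconnect_iter.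
move=> k /andP[k0 kT] fk.
(* A return at time k confines the orbit to its first k points, too few to fill [T]. *)
have lp : looping f x0 k by rewrite /looping fk -(prednK k0) inE eqxx.
suff: (#|T| <= size (traject f x0 k))%N by rewrite size_traject leqNgt kT.
apply: leq_trans (card_size _); apply: subset_leq_card.
by apply/fintype.subsetP => y _; have [i <-] := ftr x0 y; move/loopingP: lp.
Qed.

(* The least period of x0 divides 3^n but no smaller power of 3, so it is #|T|. *)
Lemma transitive_of_period (T : finType) (f : T -> T) (x0 : T) n :
  #|T| = (3 ^ n)%N -> iter (3 ^ n) f x0 = x0 ->
  (forall m, (m < n)%N -> iter (3 ^ m) f x0 <> x0) ->
  forall x y, exists k, iter k f x = y.
Proof.
move=> cT fN fm.
have exk : exists k, (0 < k)%N && (iter k f x0 == x0).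
  by exists (3 ^ n)%N; rewrite expn_gt0 fN eqxx.
case: (ex_minnP exk) => k /andP[k0 /eqP fk] kmin.
have k_dvd : (k %| 3 ^ n)%N.
  move: fN; rewrite {1}(divn_eq (3 ^ n) k) addnC iterD iter_mul_fix // => fr.
  rewrite /dvdn -leqn0 leqNgt; apply/negP => r0.
  have := kmin (3 ^ n %% k)%N; rewrite r0 fr eqxx => /(_ isT).
  by rewrite leqNgt ltn_mod k0.
have kE : k = (3 ^ n)%N.
  have [e le_en kE] := dvdn_pfactor _ _ (isT : prime 3) k_dvd.
  move: le_en; rewrite leq_eqVlt => /orP[/eqP <- //|/fm].
  by rewrite -kE fk.
subst k; pose h (i : 'I_(3 ^ n)) := iter i f x0.
(* A coincidence at times i < j would bring [x0] back after 3^n - j + i steps, before its least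
   period. *)
have h_lt (i j : 'I_(3 ^ n)) : (i < j)%N -> h i <> h j.
  move=> ij hij; have jN := ltn_ord j.
  have := kmin (3 ^ n - j + i)%N.
  rewrite iterD -/(h i) hij -iterD subnK ?(ltnW jN) // fN eqxx andbT; lia.
have h_inj : injective h.
  move=> i j hij; apply: val_inj; case: (ltngtP i j) => // ij.
    by case: (h_lt i j).
  by case: (h_lt j i).
have onto y : exists i, y = iter i f x0.
  have [|h' _ h'K] := inj_card_bij h_inj; first by rewrite cT card_ord.
  by exists (h' y); rewrite -/(h (h' y)) h'K.
move=> x y; have [a ->] := onto x; have [b ->] := onto y.
(* From time a, run forward to the multiple a 3^n of the period, which is back at [x0], then b steps
   further. *)
exists (b + (a * 3 ^ n - a))%N; rewrite -iterD -addnA subnK; last first.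
  by rewrite leq_pmulr // expn_gt0.
by rewrite iterD iter_mul_fix.
Qed.

Lemma open_Z3E (O : set Z3) : open O = Z3_open O.
Proof. by []. Qed.

Lemma minimal_systemP (f : Z3 -> Z3) :
  minimal_system f <->
  forall n x y, exists k, iter k f x ≡ y [mod 3 ^ n].
Proof.
split=> [fmin n x y|ftr x O [y Oy]].
  have [||z [zy [k _ kz]]] := fmin x [set z : Z3 | z ≡ y [mod 3 ^ n]]%classic.
  - by exists y; exact: eqmod_refl.
  - by rewrite open_Z3E => z zy; exists n => w wz; apply: eqmod_trans wz zy.
  - by exists k; rewrite kz.
rewrite open_Z3E => /(_ y Oy)[n nO]; have [k ky] := ftr n x y.
by exists (iter k f x); split; [exact: nO|exists k].
Qed.

Lemma eqmod_residueK (x : Z3) n : x ≡ (residue x n)%:R [mod 3 ^ n].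
Proof. by apply/eqmod_residue; rewrite residue_nat residue_mod. Qed.

Definition residue_ord n (x : Z3) : 'I_(3 ^ n) := Ordinal (residue_lt x n).

Lemma residue_ord_eq n (x y : Z3) :
  residue_ord n x = residue_ord n y <-> x ≡ y [mod 3 ^ n].
Proof.
rewrite eqmod_residue; split=> [/(congr1 val) //|xy]; exact: val_inj.
Qed.

(** The Lipschitz hypothesis lets [f] descend to a map [phi n] of Z/3^n, and minimality is the
    transitivity of every [phi n]. The two congruences say that 3^n is a return time of 0 at level n
    but not at level n + 1. *)
Lemma minimal_criterion (f : Z3 -> Z3) :
  (forall n x y, x ≡ y [mod 3 ^ n] -> f x ≡ f y [mod 3 ^ n]) ->
  minimal_system f <->
  forall n, iter (3 ^ n) f 0 ≡ 0 [mod 3 ^ n] /\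
            ~ iter (3 ^ n) f 0 ≡ 0 [mod 3 ^ n.+1].
Proof.
move=> f_lip; rewrite minimal_systemP.
pose phi n (i : 'I_(3 ^ n)) := residue_ord n (f i%:R).
have phiE n k x : residue_ord n (iter k f x) = iter k (phi n) (residue_ord n x).
  elim: k => //= k <-; apply/residue_ord_eq/f_lip; exact: eqmod_residueK.
have piK n (i : 'I_(3 ^ n)) : residue_ord n i%:R = i.
  by apply: val_inj; rewrite /= residue_nat modn_small.
have iterE n k : iter k f 0 ≡ 0 [mod 3 ^ n] <->
    iter k (phi n) (residue_ord n 0) = residue_ord n 0.
  by rewrite -phiE residue_ord_eq.
split=> [ftr n|f0 n x y].
  have phitr m (i j : 'I_(3 ^ m)) : exists k, iter k (phi m) i = j.
    have [k kj] := ftr m i%:R j%:R; exists k.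
    by rewrite -[i]piK -phiE -[RHS]piK residue_ord_eq.
  have [] := transitive_order _ _ (residue_ord n 0) (phitr n).
  rewrite card_ord => fN _; split; first exact/iterE.
  have [_] := transitive_order _ _ (residue_ord n.+1 0) (phitr n.+1).
  rewrite card_ord iterE; apply.
  by rewrite expn_gt0 ltn_exp2l ?ltnSn.
have [|||k] := transitive_of_period _ (phi n) (residue_ord n 0) n _ _ _
  (residue_ord n x) (residue_ord n y).
- by rewrite card_ord.
- by apply/iterE; case: (f0 n).
(* For m < n, a return modulo 3^n at time 3^m would also be a return modulo 3^(m+1). *)
- move=> m mn /iterE fm; case: (f0 m) => _; apply.
  have := @Z3_multiples_exp _ _ mn _ fm; done.
by rewrite -phiE residue_ord_eq; exists k.
Qed.

(** * Threefold compositions of polynomials *)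

Lemma red3_3 : red3 3 = 0.
Proof. exact/eqP. Qed.

Lemma red3_horner (p : {poly Z3}) (x y : Z3) :
  red3 x = red3 y -> red3 p.[x] = red3 p.[y].
Proof. by move=> /red3_eq xy; apply/red3_eq/eqmod_horner. Qed.

Lemma horner_take_drop (R : comNzRingType) n (p : {poly R}) (x : R) :
  p.[x] = (take_poly n p).[x] + x ^+ n * (drop_poly n p).[x].
Proof.
by rewrite -[in LHS](poly_take_drop n p) hornerD hornerM hornerXn mulrC.
Qed.

Lemma horner_order2 (R : comNzRingType) (p : {poly R}) (x : R) :
  exists r, p.[x] = p`_0 + p`_1 * x + x ^+ 2 * r.
Proof.
exists (drop_poly 2 p).[x]; rewrite (horner_take_drop _ 2).
by rewrite horner_poly big_ord_recl big_ord1 expr0 mulr1 expr1.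
Qed.

Lemma horner_order3 (R : comNzRingType) (p : {poly R}) (x : R) :
  exists r, p.[x] = p`_0 + p`_1 * x + p`_2 * x ^+ 2 + x ^+ 3 * r.
Proof.
exists (drop_poly 3 p).[x]; rewrite (horner_take_drop _ 3).
rewrite horner_poly !big_ord_recl big_ord0 addr0 /= !addrA.
by rewrite expr0 mulr1 expr1.
Qed.

Definition comp3 {R : nzRingType} (p : {poly R}) := p \Po (p \Po p).

Lemma horner_comp3 (p : {poly Z3}) (x : Z3) :
  (comp3 p).[x] = p.[p.[p.[x]]].
Proof. by rewrite !horner_comp. Qed.

Lemma horner_iter_comp3 (p : {poly Z3}) (x : Z3) n :
  (iter n comp3 p).[x] = iter (3 ^ n) (horner p) x.
Proof.
elim: n x => //= n IHn x; rewrite horner_comp3 !IHn -!iterD.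
by rewrite expnS !mulSn mul0n addn0 addnA.
Qed.

(** The coefficient of X is the derivative at 0, so this is the chain rule along the orbit of 0. *)
Lemma coef1_comp3 (p : {poly Z3}) :
  (comp3 p)`_1 = p^`().[p.[p`_0]] * (p^`().[p`_0] * p`_1).
Proof.
have coef1 (q : {poly Z3}) : q`_1 = q^`().[0].
  by rewrite horner_coef0 coef_deriv.
by rewrite -(horner_coef0 p) !coef1 !deriv_comp !(hornerM, horner_comp).
Qed.

(* Stated for twice the coefficient, which is the second derivative at 0. *)
Lemma coef2_comp3 (p : {poly Z3}) :
  (comp3 p)`_2 *+ 2 =
    p^`(2).[p.[p`_0]] * (p^`().[p`_0] * p`_1) ^+ 2 +
    p^`().[p.[p`_0]] *
      (p^`(2).[p`_0] * p`_1 ^+ 2 + p^`().[p`_0] * (p`_2 *+ 2)).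
Proof.
have coef1 (q : {poly Z3}) : q`_1 = q^`().[0].
  by rewrite horner_coef0 coef_deriv.
have coef2 (q : {poly Z3}) : q`_2 *+ 2 = q^`(2).[0].
  by rewrite horner_coef0 coef_derivn.
rewrite -(horner_coef0 p) !coef1 !coef2 /derivn /= !deriv_comp.
rewrite !derivM !deriv_comp.
rewrite !(hornerD, hornerM, horner_comp); ring.
Qed.

Lemma red3_coef1_comp3 (p : {poly Z3}) :
  red3 p`_0 = 0 -> red3 (comp3 p)`_1 = red3 p`_1 ^+ 3.
Proof.
move=> p0; have d_red x : red3 x = 0 -> red3 p^`().[x] = red3 p`_1.
  move=> x0; rewrite (red3_horner _ _ 0) ?x0 ?rmorph0 //.
  by rewrite horner_coef0 coef_deriv.
rewrite coef1_comp3 !rmorphM /= !d_red //.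
by rewrite (red3_horner _ _ 0) ?horner_coef0 // p0 rmorph0.
Qed.

Definition grows n (p : {poly Z3}) :=
  (exists2 u, p`_0 = (3 ^ n)%:R * u & red3 u <> 0) /\ red3 p`_1 = 1.

(** With linear coefficient a = 1 + 3e, the three steps contribute the factor 1 + a + a^2, which is
    3 modulo 9. The quadratic remainders are multiples of 3^(2n), hence of 3^(n+2) because n >=
    2. *)
Lemma grows_comp3 n (p : {poly Z3}) :
  (1 < n)%N -> grows n p -> grows n.+1 (comp3 p).
Proof.
case: n => [|[|n]] // _ [[u p0 u0] p1]; split; last first.
  rewrite red3_coef1_comp3 ?p1 ?expr1n //.
  by rewrite p0 expnS natrM -mulrA rmorphM /= red3_3 mul0r.
have /Z3_eqmodP[e p1E] : p`_1 ≡ 1 [mod 3].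
  by apply/red3_eq; rewrite p1 rmorph1.
rewrite -horner_coef0 horner_comp3 horner_coef0.
have [r1 ->] := horner_order2 _ p p`_0.
set h2 := (X in p.[X]); have [r2 ->] := horner_order2 _ p h2.
(* Here [n] is the level minus 2. With T = 3^n the constant term is 9Tu, and its square 81T^2u^2 is
   3 times a multiple of 27T, so it does not affect the new unit modulo 3. *)
have T9 : (3 ^ n.+2)%:R = 9%:R * (3 ^ n)%:R :> Z3.
  by rewrite -natrM !expnS !mulnA.
have T27 : (3 ^ n.+3)%:R = 27%:R * (3 ^ n)%:R :> Z3.
  by rewrite -natrM !expnS !mulnA.
rewrite {}/h2 p1E p0 T9 T27; set T := (3 ^ n)%:R.
exists (u + 3%:R * (u * (e + e ^+ 2) + (1 + 3%:R * e) * T * u ^+ 2 * r1 +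
  T * (u * (2%:R + 3%:R * e) + 9%:R * T * u ^+ 2 * r1) ^+ 2 * r2)).
  ring.
by rewrite rmorphD rmorphM /= red3_3 mul0r addr0.
Qed.

(** A universal quantifier over 'Z_3 that [vm_compute] evaluates; it nests for several variables. *)
Definition all_mod3 (P : 'Z_3 -> bool) := [&& P 0, P 1 & P 2].

Lemma all_mod3P (P : 'Z_3 -> bool) : reflect (forall x, P x) (all_mod3 P).
Proof.
apply: (iffP and3P) => [[P0 P1 P2]|allP]; last by split.
case=> [[|[|[|//]]] lt3].
- by rewrite (_ : Ordinal lt3 = 0) //; exact: val_inj.
- by rewrite (_ : Ordinal lt3 = 1) //; exact: val_inj.
- by rewrite (_ : Ordinal lt3 = 2) //; exact: val_inj.
Qed.

(** Modulo 3, 1 + a + a^2 = (a - 1)^2. *)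
Lemma mod3_mul_1aa (a b : 'Z_3) :
  b != 0 -> (b * (1 + a + a ^+ 2) == 0) = (a == 1).
Proof.
have /all_mod3P/(_ a)/all_mod3P/(_ b) : all_mod3 (fun a => all_mod3 (fun b =>
  (b != 0) ==> ((b * (1 + a + a ^+ 2) == 0) == (a == 1)))) by vm_compute.
by move=> /implyP/[apply]/eqP.
Qed.

(** Modulo 3, 5 = -1 and the left side is b(1 - cb). *)
Lemma mod3_mul_5cb (b c : 'Z_3) :
  b != 0 -> (b + 5%:R * (c * b ^+ 2) == 0) = (c * b == 1).
Proof.
have /all_mod3P/(_ b)/all_mod3P/(_ c) : all_mod3 (fun b => all_mod3 (fun c =>
  (b != 0) ==> ((b + 5%:R * (c * b ^+ 2) == 0) == (c * b == 1)))) by vm_compute.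
by move=> /implyP/[apply]/eqP.
Qed.

Lemma eqmod_congr0 m (x y : Z3) :
  x ≡ y [mod m] -> (x ≡ 0 [mod m] <-> y ≡ 0 [mod m]).
Proof.
by move=> xy; split; apply: eqmod_trans => //; exact: eqmod_sym.
Qed.

Lemma red3_mul3 n (x : Z3) :
  (3 ^ n)%:R * x ≡ 0 [mod 3 ^ n.+1] <-> red3 x = 0.
Proof. by rewrite -red3_eq0 -(eqmod_pow3_mull n 1) addn1. Qed.

Lemma comp3_base (p : {poly Z3}) b : p`_0 = 3%:R * b -> red3 b <> 0 ->
  ((comp3 p).[0] ≡ 0 [mod 3 ^ 2] /\
   ~ (comp3 p).[0] ≡ 0 [mod 3 ^ 3]) <->
  red3 p`_1 = 1 /\ red3 (p`_2 * b) <> 1.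
Proof.
move=> p0 b0; rewrite horner_comp3 horner_coef0.
have [r1 ->] := horner_order3 _ p p`_0.
set h2 := (X in p.[X]); have [r2 ->] := horner_order3 _ p h2.
rewrite {}/h2 p0; set a := p`_1; set c := p`_2.
set x := (X in X ≡ 0 [mod 3 ^ 2]).
have [w xE] : exists w, x = 3%:R * (b * (1 + a + a ^+ 2)) +
    9%:R * (c * b ^+ 2 * (a + (1 + a) ^+ 2)) + 27%:R * w.
  (* The middle point of the orbit is 3(b + ab + 3m), so its cube, like that of 3b, is a multiple of
     27. *)
  pose m := c * b ^+ 2 + 3%:R * b ^+ 3 * r1.
  exists (a * b ^+ 3 * r1 + c * (2%:R * (b + a * b) * m + 3%:R * m ^+ 2) +
          (b + a * b + 3%:R * m) ^+ 3 * r2).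
  by rewrite /x /m; ring.
have a1 : x ≡ 0 [mod 3 ^ 2] <-> red3 a = 1.
  rewrite (eqmod_congr0 _ _ ((3 ^ 1)%:R * (b * (1 + a + a ^+ 2)))); last first.
    apply/Z3_eqmodP; exists (c * b ^+ 2 * (a + (1 + a) ^+ 2) + 3%:R * w).
    by rewrite xE; ring.
  rewrite red3_mul3 rmorphM !rmorphD rmorphXn rmorph1 /=.
  have E := mod3_mul_1aa (red3 a) (red3 b) (introN eqP b0).
  by split=> /eqP; [rewrite E|rewrite -E] => /eqP.
(* For a = 1 + 3e, 1 + a + a^2 is 3 modulo 9 and a + (1 + a)^2 is 5 modulo 3, whence the 5. *)
have x27 : red3 a = 1 -> (x ≡ 0 [mod 3 ^ 3] <-> red3 (c * b) = 1).
  rewrite -(rmorph1 red3) => /red3_eq/Z3_eqmodP[e aE].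
  rewrite (eqmod_congr0 _ _ ((3 ^ 2)%:R * (b + 5%:R * (c * b ^+ 2)))).
    rewrite red3_mul3 rmorphD 2!rmorphM rmorphXn rmorph_nat rmorphM /=.
    have E := mod3_mul_5cb (red3 b) (red3 c) (introN eqP b0).
    by split=> /eqP; [rewrite E|rewrite -E] => /eqP.
  apply/Z3_eqmodP; rewrite xE aE.
  exists (b * (e + e ^+ 2) + c * b ^+ 2 * (5%:R * e + 3%:R * e ^+ 2) + w); ring.
split=> -[xa xb]; split; first exact/a1.
- by move=> cb; apply/xb/x27 => //; exact/a1.
- exact/a1.
- by move=> /(x27 xa).
Qed.

Lemma grows_iter n (p : {poly Z3}) :
  grows n p -> p.[0] ≡ 0 [mod 3 ^ n] /\ ~ p.[0] ≡ 0 [mod 3 ^ n.+1].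
Proof.
move=> [[u p0 u0] _]; rewrite horner_coef0 p0 red3_mul3; split=> //.
by apply/Z3_eqmod0P; exists u.
Qed.

Lemma grows_comp3_base (p : {poly Z3}) b :
  p`_0 = 3%:R * b -> red3 b <> 0 -> red3 p`_1 = 1 -> red3 (p`_2 * b) <> 1 ->
  grows 2 (comp3 p).
Proof.
move=> p0 b0 p1 cb; have [_ /(_ (conj p1 cb))] := comp3_base p b p0 b0.
rewrite horner_coef0 => -[/Z3_eqmod0P[u uE] u0]; split.
  by exists u => //; move: u0; rewrite uE red3_mul3.
by rewrite red3_coef1_comp3 ?p1 ?expr1n // p0 rmorphM /= red3_3 mul0r.
Qed.

(** Level 0 says that the constant term is a unit, level 1 gives [b], and level 2 is [comp3_base]
    applied to [comp3 p]. Conversely, [grows] starts at level 2 and propagates by induction. *)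
Lemma poly_minimal_criterion (p : {poly Z3}) :
  (forall n, iter (3 ^ n) (horner p) 0 ≡ 0 [mod 3 ^ n] /\
             ~ iter (3 ^ n) (horner p) 0 ≡ 0 [mod 3 ^ n.+1]) <->
  red3 p`_0 <> 0 /\
  exists b, [/\ (comp3 p)`_0 = 3%:R * b, red3 b <> 0,
    red3 (comp3 p)`_1 = 1 & red3 ((comp3 p)`_2 * b) <> 1].
Proof.
have iterE n : iter (3 ^ n) (horner p) 0 = (iter n comp3 p).[0].
  by rewrite horner_iter_comp3.
split=> [pn|[p0 [b [b0 b3 p1 cb]]] n].
  split.
    have [_] := pn 0%N; rewrite iterE /= horner_coef0.
    by move=> p0 /red3_eq0.
  have [] := pn 1%N; rewrite !iterE /= horner_coef0.
  move=> /Z3_eqmod0P[b b0] b3; exists b.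
  have {}b3 : red3 b <> 0 by move: b3; rewrite b0 red3_mul3.
  by have := pn 2; rewrite !iterE /= => /(comp3_base _ b b0 b3)[p1 cb].
rewrite iterE; case: n => [|[|n]] /=.
- split; first by apply/Z3_eqmod0P; exists p.[0]; rewrite mul1r.
  by rewrite horner_coef0 => /red3_eq0.
- rewrite horner_coef0 b0; split; last by rewrite (red3_mul3 1).
  by apply/Z3_eqmod0P; exists b.
rewrite -!iterS; apply: grows_iter; elim: n => [|n IHn].
  exact: grows_comp3_base b0 b3 p1 cb.
by rewrite iterS; exact: grows_comp3.
Qed.

(** * Normalization of the constant term *)

(* [p`_0 * (normalized p).[x] = p.[p`_0 * x]]; the coefficients avoid dividing
   by [p`_0]. *)
Definition normalized (p : {poly Z3}) : {poly Z3} :=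
  \poly_(i < (size p).+1) if i is j.+1 then p`_i * p`_0 ^+ j else 1.

Lemma normalized_coef0 (p : {poly Z3}) : (normalized p)`_0 = 1.
Proof. by rewrite coef_poly. Qed.

Lemma normalized_coefS (p : {poly Z3}) i :
  (normalized p)`_i.+1 = p`_i.+1 * p`_0 ^+ i.
Proof.
rewrite coef_poly; case: ltnP => // le_pi.
by rewrite nth_default ?mul0r // ltnW.
Qed.

Lemma size_normalized (p : {poly Z3}) : (size (normalized p) <= (size p).+1)%N.
Proof. exact: size_poly. Qed.

Lemma horner_normalized (p : {poly Z3}) (x : Z3) :
  p`_0 * (normalized p).[x] = p.[p`_0 * x].
Proof.
rewrite (horner_coef_wide _ (size_normalized p)).
rewrite (@horner_coef_wide _ (size p).+1 p) // !big_ord_recl.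
rewrite normalized_coef0 !expr0 !mulr1 mulrDr mulr1 mulr_sumr; congr (_ + _).
apply: eq_bigr => i _.
  rewrite !lift0 normalized_coefS exprMn (exprS p`_0); ring.
Qed.

Lemma iter_normalized (p : {poly Z3}) k :
  iter k (horner p) 0 = p`_0 * iter k (horner (normalized p)) 0.
Proof.
by elim: k => [|k IHk] /=; rewrite ?mulr0 // horner_normalized -IHk.
Qed.

(** The left side covers the indices 1 to n, the right side stops before n; in the applications n is
    [size p], where the coefficient vanishes. *)
Lemma sum_parity (V : zmodType) (F : nat -> V) n : F n = 0 ->
  \sum_(i < n) F i.+1 =
    \sum_(2 <= i < n | ~~ odd i) F i + \sum_(1 <= i < n | odd i) F i.
Proof.
case: n => [|n] Fn; first by rewrite big_ord0 !big_geq // addr0.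
rewrite big_ord_recr /= Fn addr0 -(big_mkord xpredT (fun i => F i.+1)).
rewrite -(big_add1 _ _ 0 n.+1 xpredT F) (bigID odd) /= addrC; congr (_ + _).
case: n {Fn} => [|n]; first by rewrite !big_geq.
by rewrite big_ltn_cond.
Qed.

Lemma expr_sqr1 (R : comNzRingType) (x : R) i :
  x ^+ 2 = 1 -> x ^+ i = x ^+ odd i.
Proof.
move=> x2; rewrite -[in LHS](odd_double_half i) exprD -mul2n exprM x2.
by rewrite expr1n mulr1.
Qed.

(** At 1 and -1 a power depends only on the parity of its exponent, which is the origin of the
    splitting into A'0 and A'1. *)
Lemma normalized_sqr1 (p : {poly Z3}) (x : Z3) : x ^+ 2 = 1 ->
  (normalized p).[x] = 1 + coefA'0 p + x * coefA'1 p.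
Proof.
move=> x2; rewrite (horner_coef_wide _ (size_normalized p)) big_ord_recl.
rewrite normalized_coef0 mulr1 -addrA; congr (_ + _).
transitivity (\sum_(i < size p) p`_i.+1 * p`_0 ^+ i * x ^+ odd i.+1).
  by apply: eq_bigr => i _; rewrite normalized_coefS lift0 (expr_sqr1 _ _ _ x2).
rewrite (sum_parity _ (fun i => p`_i * p`_0 ^+ i.-1 * x ^+ odd i)); last first.
  by rewrite nth_default // !mul0r.
rewrite mulr_sumr; congr (_ + _); apply: eq_bigr => i.
  by move=> /negPf ->; rewrite mulr1.
by move=> ->; rewrite mulrC.
Qed.

(** Differentiation lowers exponents by one and swaps parities, so the factor x now goes with the
    even indices. *)
Lemma deriv_normalized_sqr1 (p : {poly Z3}) (x : Z3) : x ^+ 2 = 1 ->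
  (normalized p)^`().[x] = x * coefD'0 p + coefD'1 p.
Proof.
move=> x2; have szd : (size (normalized p)^`() <= size p)%N.
  rewrite (leq_trans (size_poly _ _)) // -subn1 leq_subLR.
  exact: size_normalized.
rewrite (horner_coef_wide _ szd).
transitivity
    (\sum_(i < size p) i.+1%:R * p`_i.+1 * p`_0 ^+ i * x ^+ (~~ odd i.+1)).
  apply: eq_bigr => i _.
  rewrite coef_deriv normalized_coefS (expr_sqr1 _ _ i x2).
  by rewrite /= negbK -[_ *+ i.+1]mulr_natl mulrA.
rewrite (sum_parity _ (fun i => i%:R * p`_i * p`_0 ^+ i.-1 * x ^+ (~~ odd i))).
  rewrite mulr_sumr; congr (_ + _); apply: eq_bigr => i.
    by move=> /negPf ->; rewrite mulrC.
  by move=> ->; rewrite mulr1.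
by rewrite nth_default // mulr0 !mul0r.
Qed.

Lemma sum_blocks6 (V : zmodType) (F : nat -> V) n :
  \sum_(i < 6 * n) F i =
  \sum_(0 <= j < n) (F (6 * j)%N + F (6 * j).+1 + F (6 * j).+2 + F (6 * j).+3 +
                     F (6 * j).+4 + F (6 * j).+4.+1).
Proof.
rewrite -(big_mkord xpredT); elim: n => [|n IHn]; first by rewrite !big_geq.
by rewrite mulnS !big_nat_recr //= IHn !addrA.
Qed.

(** Modulo 3, (i+2)(i+1) is 2 when 3 divides i and 0 otherwise, while x^i depends on i modulo 2. In
    each block of 6 only i = 0 and i = 3 survive; they carry the coefficients of [p] of index 2 and
    5 modulo 6. *)
Lemma red3_deriv2_normalized_sqr1 (p : {poly Z3}) (x : Z3) : x ^+ 2 = 1 ->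
  red3 (normalized p)^`(2).[x] =
    2 * (red3 (coefS2 p) + red3 x * red3 (coefS5 p)).
Proof.
(* Padding with zero coefficients gives exactly as many blocks of 6 as there are values of j in
   [coefS2] and [coefS5]. *)
move=> x2; have szd : (size (normalized p)^`(2) <= 6 * size p)%N.
  apply: leq_trans (size_poly _ _) _.
  apply: leq_trans (leq_pred _) _; apply: leq_trans (size_poly _ _) _.
  have := size_normalized p; lia.
rewrite (horner_coef_wide _ szd) rmorph_sum.
have natr_addn6 r j : (r + 6 * j)%:R = r%:R :> 'Z_3.
  by rewrite -mod3_natr -[RHS]mod3_natr; congr (_%:R); lia.
have term j r : red3 ((normalized p)^`(2)`_(r + 6 * j) * x ^+ (r + 6 * j)) =
    (r.+2 * r.+1)%:R * red3 (p`_(r.+2 + 6 * j) * p`_0 ^+ (r.+1 + 6 * j)) *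
    red3 x ^+ r.
  rewrite coef_derivn normalized_coefS -[_ *+ (_ ^_ 2)]mulr_natl.
  rewrite rmorphM /= rmorphM /= rmorph_nat ffactnS ffactn1 natrM.
  rewrite exprD exprM (expr_sqr1 _ _ 6 x2) expr1n mulr1 rmorphXn /=.
  by rewrite (natr_addn6 r.+2) (natr_addn6 r.+1) -natrM.
rewrite (sum_blocks6 _ (fun i => red3 ((normalized p)^`(2)`_i * x ^+ i))).
rewrite !rmorph_sum mulr_sumr -big_split mulr_sumr /=; apply: eq_bigr => j _.
have := term j 0%N; have := term j 1%N; have := term j 2%N.
have := term j 3%N; have := term j 4%N; have := term j 5%N.
rewrite !addSn !add0n => -> -> -> -> -> ->.
have -> : red3 x ^+ 3 = red3 x by rewrite -rmorphXn (expr_sqr1 _ _ 3 x2).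
have -> : (2 * 1)%:R = 2 :> 'Z_3 by exact/eqP.
have -> : (3 * 2)%:R = 0 :> 'Z_3 by exact/eqP.
have -> : (4 * 3)%:R = 0 :> 'Z_3 by exact/eqP.
have -> : (5 * 4)%:R = 2 :> 'Z_3 by exact/eqP.
have -> : (6 * 5)%:R = 0 :> 'Z_3 by exact/eqP.
have -> : (7 * 6)%:R = 0 :> 'Z_3 by exact/eqP.
ring.
Qed.

(** * Conditions modulo 3 and 9 *)

(** The middle condition reads (d1^2 - d0^2) l = 1: exactly one of d0, d1 vanishes, and l is 1 or 2
    accordingly. This yields the four cases; inside each one the other variables are enumerated. *)
Lemma mod3_conditions (α β d0 d1 l t s2 s5 b c : 'Z_3) :
  b = α - β + (d1 - d0) * (1 + α + β) ->
  c *+ 2 = 2 * (s2 - s5) * ((d0 + d1) * l) ^+ 2 +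
    (d1 - d0) * (2 * (s2 + s5) * l ^+ 2 + (d0 + d1) * (t *+ 2)) ->
  b <> 0 /\ (d1 - d0) * ((d0 + d1) * l) = 1 /\ c * b <> 1 <->
  (d0 = 0 /\ d1 = 2 /\ l = 1 /\ β + 2 <> 0 /\ β + 2 <> t + s5) \/
  (d0 = 0 /\ d1 = 1 /\ l = 1 /\ α + 2 <> 0 /\ α + 2 <> 2 * t + s2) \/
  (d0 = 1 /\ d1 = 0 /\ l = 2 /\ β + 2 <> 0 /\ β + 2 <> 2 * t + s5) \/
  (d0 = 2 /\ d1 = 0 /\ l = 2 /\ α + 2 <> 0 /\ α + 2 <> t + s2).
Proof.
(* The hypothesis gives 2c; since 4 = 1 modulo 3, doubling it again recovers c. *)
move=> -> /(congr1 ( *%R 2)) c2.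
have {c2} -> : c = 2 * (2 * (s2 - s5) * ((d0 + d1) * l) ^+ 2 +
    (d1 - d0) * (2 * (s2 + s5) * l ^+ 2 + (d0 + d1) * (t *+ 2))).
  rewrite -c2; have -> : 2 * (c *+ 2) = c + 3%:R * c by ring.
  by rewrite (_ : 3%:R = 0) ?mul0r ?addr0 //; exact/eqP.
rewrite !(rwP eqP) !(rwP negP) !(rwP andP) !(rwP orP).
have live : ((d1 - d0) * ((d0 + d1) * l) == 1) ==
    [|| [&& d0 == 0, d1 == 2 & l == 1], [&& d0 == 0, d1 == 1 & l == 1],
        [&& d0 == 1, d1 == 0 & l == 2] | [&& d0 == 2, d1 == 0 & l == 2]].
  move: l; apply/all_mod3P; move: d1; apply/all_mod3P.
  move: d0; apply/all_mod3P.
  by vm_compute.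
have iff_eqb (x y : bool) : x == y -> x <-> y by move/eqP->.
apply: iff_eqb; rewrite (eqP live).
case: (boolP [|| _, _, _ | _]) => [/or4P[]/and3P[/eqP-> /eqP-> /eqP->]|].
1-4: move: β; apply/all_mod3P; move: α; apply/all_mod3P.
1-4: move: s5; apply/all_mod3P.
1-4: by move: s2; apply/all_mod3P; move: t; apply/all_mod3P; vm_compute.
rewrite andbF.
by do 3![case: (d0 == _)]; do 3![case: (d1 == _)]; do 2![case: (l == _)].
Qed.

(** Level 0 forces the constant term of [p] to be a unit; the orbits of 0 under [p] and
    [normalized p] then differ by this unit factor and have the same valuations. *)
Lemma minimal_normalized (p : {poly Z3}) :
  minimal_system (fun x : Z3 => p.[x]) <->
  ~ p`_0 ≡ 0 [mod 3] /\
  exists b, [/\ (comp3 (normalized p))`_0 = 3%:R * b, red3 b <> 0,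
    red3 (comp3 (normalized p))`_1 = 1 &
    red3 ((comp3 (normalized p))`_2 * b) <> 1].
Proof.
set q := normalized p.
have qE n : ~ p`_0 ≡ 0 [mod 3] -> forall m,
    iter (3 ^ m) (horner p) 0 ≡ 0 [mod 3 ^ n] <->
    iter (3 ^ m) (horner q) 0 ≡ 0 [mod 3 ^ n].
  by move=> p0 m; rewrite iter_normalized eqmod_unit_mull.
have q0 : red3 q`_0 <> 0 by rewrite normalized_coef0 rmorph1; exact/eqP.
rewrite minimal_criterion; last by move=> n x y; exact: eqmod_horner.
have -> : (forall n, iter (3 ^ n) (horner p) 0 ≡ 0 [mod 3 ^ n] /\
    ~ iter (3 ^ n) (horner p) 0 ≡ 0 [mod 3 ^ n.+1]) <->
    ~ p`_0 ≡ 0 [mod 3] /\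
    forall n, iter (3 ^ n) (horner q) 0 ≡ 0 [mod 3 ^ n] /\
    ~ iter (3 ^ n) (horner q) 0 ≡ 0 [mod 3 ^ n.+1].
  split=> [pn|[p0 qn] n]; last by rewrite !qE.
  have p0 : ~ p`_0 ≡ 0 [mod 3] by have [_] := pn 0%N; rewrite /= horner_coef0.
  by split=> // n; rewrite -!qE.
by rewrite poly_minimal_criterion; split=> [[? []]|[? ?]].
Qed.

(** Since q(0) = 1 and q(q(1)) = 0 modulo 3, q(1) can be neither 0 nor 1. So q(1) = -1 and q(-1) =
    0, two linear equations for A'0 and A'1. *)
Lemma cycle3_coefs (p : {poly Z3}) :
  red3 (comp3 (normalized p))`_0 = 0 ->
  red3 (coefA'0 p) = 0 /\ red3 (coefA'1 p) = 1.
Proof.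
set q := normalized p.
rewrite -horner_coef0 horner_comp3 horner_coef0 normalized_coef0 => cyc.
have q1 : red3 q.[1] = 1 + red3 (coefA'0 p) + red3 (coefA'1 p).
  by rewrite normalized_sqr1 ?expr1n // mul1r !rmorphD rmorph1.
have qN1 : red3 q.[-1] = 1 + red3 (coefA'0 p) - red3 (coefA'1 p).
  by rewrite normalized_sqr1 ?sqrrN ?expr1n //
    mulN1r !rmorphD rmorphN rmorph1.
have q_at c : red3 q.[1] = red3 c -> red3 q.[c] = 0.
  by move=> /red3_horner <-.
have : red3 q.[1] <> 0.
  move=> q10; have := q_at 0; rewrite q10 rmorph0 => /(_ erefl).
  by rewrite horner_coef0 normalized_coef0 rmorph1 => /eqP.
have : red3 q.[1] <> 1.
  move=> q11; have := q_at 1; rewrite q11 rmorph1 => /(_ erefl).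
  by move=> /eqP.
have : red3 q.[1] = -1 -> red3 q.[-1] = 0.
  by move=> q12; apply: q_at; rewrite q12 rmorphN rmorph1.
rewrite q1 qN1; move: (red3 (coefA'0 p)) (red3 (coefA'1 p)).
move=> a0 a1; rewrite !(rwP eqP) !(rwP negP) !(rwP andP) !(rwP implyP).
move: a1; apply/all_mod3P; move: a0; apply/all_mod3P.
by vm_compute.
Qed.

Lemma eqmod9_mul3 (x y : Z3) :
  3%:R * x ≡ 3%:R * y [mod 9] <-> red3 x = red3 y.
Proof.
rewrite -red3_eq /Z3_eqmod -mulrBr.
have := eqmod_pow3_mull 1 1 (x - y); rewrite /Z3_eqmod !subr0; exact.
Qed.

Lemma horner_taylor2 (R : comNzRingType) (p : {poly R}) (x h : R) :
  exists r, p.[x + h] = p.[x] + p^`().[x] * h + h ^+ 2 * r.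
Proof.
have [r rE] := horner_order2 _ (p \Po ('X + x%:P)) h; exists r.
have c0 : (p \Po ('X + x%:P))`_0 = p.[x].
  by rewrite -horner_coef0 horner_comp hornerD hornerX hornerC add0r.
have c1 : (p \Po ('X + x%:P))`_1 = p^`().[x].
  have -> : (p \Po ('X + x%:P))`_1 = (p \Po ('X + x%:P))^`().[0].
    by rewrite horner_coef0 coef_deriv.
  rewrite deriv_comp derivD derivX derivC addr0 mulr1 horner_comp.
  by rewrite hornerD hornerX hornerC add0r.
by rewrite -c0 -c1 -rE horner_comp hornerD hornerX hornerC addrC.
Qed.

(** Here q(1) = -1 + 3(1 + α + β); a first-order Taylor expansion at -1 gives q(q(1)) modulo 9, and
    division by 3 gives b modulo 3. *)
Lemma coef0_comp3_normalized (p : {poly Z3}) (α β : Z3) :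
  coefA'0 p = 3%:R * α -> coefA'1 p = 1 + 3%:R * β ->
  exists2 b, (comp3 (normalized p))`_0 = 3%:R * b &
    red3 b = red3 α - red3 β +
      (red3 (coefD'1 p) - red3 (coefD'0 p)) * (1 + red3 α + red3 β).
Proof.
move=> A0 A1; set q := normalized p.
have qN1 : q.[-1] = 3%:R * (α - β).
  by rewrite normalized_sqr1 ?sqrrN ?expr1n // A0 A1; ring.
have q1 : q.[1] = -1 + 3%:R * (1 + α + β).
  by rewrite normalized_sqr1 ?expr1n // A0 A1; ring.
rewrite -horner_coef0 horner_comp3 horner_coef0 normalized_coef0 q1.
have [r ->] := horner_taylor2 _ q (-1) (3%:R * (1 + α + β)).
exists (α - β + q^`().[-1] * (1 + α + β) + 3%:R * (1 + α + β) ^+ 2 * r).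
  by rewrite qN1; ring.
rewrite !(rmorphD, rmorphB) 3!rmorphM /= red3_3 !mul0r addr0.
rewrite !rmorphD rmorph1 deriv_normalized_sqr1 ?sqrrN ?expr1n //.
by rewrite mulN1r [- coefD'0 p + _]addrC rmorphB rmorphN.
Qed.

(** The chain rules of [coef1_comp3] and [coef2_comp3] are evaluated along the cycle 0, 1, -1 modulo
    3. *)
Lemma coef12_comp3_normalized (p : {poly Z3}) :
  red3 (comp3 (normalized p))`_0 = 0 ->
  let d0 := red3 (coefD'0 p) in let d1 := red3 (coefD'1 p) in
  let s2 := red3 (coefS2 p) in let s5 := red3 (coefS5 p) in
  let l := red3 p`_1 in
  red3 (comp3 (normalized p))`_1 = (d1 - d0) * ((d0 + d1) * l) /\
  red3 (comp3 (normalized p))`_2 *+ 2 =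
    2 * (s2 - s5) * ((d0 + d1) * l) ^+ 2 +
    (d1 - d0) *
      (2 * (s2 + s5) * l ^+ 2 + (d0 + d1) * (red3 (p`_2 * p`_0) *+ 2)).
Proof.
move=> cyc d0 d1 s2 s5 l; set q := normalized p.
have [A0 A1] := cycle3_coefs _ cyc.
have q1 : red3 q.[1] = red3 (-1).
  rewrite normalized_sqr1 ?expr1n // mul1r !rmorphD rmorph1 rmorphN rmorph1 /=.
  by rewrite A0 A1; exact/eqP.
have sqrN1 : (-1) ^+ 2 = 1 :> Z3 by rewrite sqrrN expr1n.
have dq1 : red3 q^`().[1] = d0 + d1.
  by rewrite deriv_normalized_sqr1 ?expr1n // mul1r rmorphD.
have dqN1 : red3 q^`().[q.[1]] = d1 - d0.
  rewrite (red3_horner _ _ _ q1) deriv_normalized_sqr1 // mulN1r addrC.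
  by rewrite rmorphB.
have q_1 : q`_1 = p`_1 by rewrite normalized_coefS expr0 mulr1.
have q_2 : q`_2 = p`_2 * p`_0 by rewrite normalized_coefS expr1.
split.
  by rewrite coef1_comp3 normalized_coef0 q_1 !rmorphM /= dqN1 dq1.
rewrite -rmorphMn /= coef2_comp3 normalized_coef0 q_1 q_2.
rewrite !(rmorphD, rmorphM, rmorphXn, rmorphMn) /= dqN1 dq1.
rewrite (red3_horner _ _ _ q1) !red3_deriv2_normalized_sqr1 ?expr1n //.
by rewrite rmorphN rmorph1 mulN1r mul1r.
Qed.

Lemma growth_conditions (p : {poly Z3}) (α β : Z3) :
  coefA'0 p = 3%:R * α -> coefA'1 p = 1 + 3%:R * β ->
  let d0 := red3 (coefD'0 p) in let d1 := red3 (coefD'1 p) in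
  let s2 := red3 (coefS2 p) in let s5 := red3 (coefS5 p) in
  let l := red3 p`_1 in let t := red3 (p`_2 * p`_0) in
  let u := red3 α + 2 in let v := red3 β + 2 in
  (exists b, [/\ (comp3 (normalized p))`_0 = 3%:R * b, red3 b <> 0,
    red3 (comp3 (normalized p))`_1 = 1 &
    red3 ((comp3 (normalized p))`_2 * b) <> 1]) <->
  (d0 = 0 /\ d1 = 2 /\ l = 1 /\ v <> 0 /\ v <> t + s5) \/
  (d0 = 0 /\ d1 = 1 /\ l = 1 /\ u <> 0 /\ u <> 2 * t + s2) \/
  (d0 = 1 /\ d1 = 0 /\ l = 2 /\ v <> 0 /\ v <> 2 * t + s5) \/
  (d0 = 2 /\ d1 = 0 /\ l = 2 /\ u <> 0 /\ u <> t + s2).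
Proof.
move=> A0 A1 /=; have [b0 cube0 b0E] := coef0_comp3_normalized p α β A0 A1.
have cyc : red3 (comp3 (normalized p))`_0 = 0.
  by rewrite cube0 rmorphM /= red3_3 mul0r.
have [c1 c2] := coef12_comp3_normalized p cyc.
rewrite -(mod3_conditions _ _ _ _ _ _ _ _ _ _ b0E c2) -c1 -rmorphM.
split=> [[b []]|[? []]]; last by exists b0.
(* Multiplication by 3 is injective, so [b] is determined by the constant term. *)
by rewrite cube0 => /(pow3_mulI 1) ->.
Qed.

(** As A'1 + 5 = 3(β + 2) and A'0 + 6 = 3(α + 2), the congruences modulo 9 are three times those
    modulo 3 in [growth_conditions]. *)
Lemma growth_conditions_mod9 (p : {poly Z3}) (α β : Z3) :
  coefA'0 p = 3%:R * α -> coefA'1 p = 1 + 3%:R * β ->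
  (exists b, [/\ (comp3 (normalized p))`_0 = 3%:R * b, red3 b <> 0,
    red3 (comp3 (normalized p))`_1 = 1 &
    red3 ((comp3 (normalized p))`_2 * b) <> 1]) <->
((coefD'0 p ≡ 0 [mod 3] /\ coefD'1 p ≡ 2%:R [mod 3] /\ p`_1 ≡ 1 [mod 3] /\
       ~ coefA'1 p + 5%:R ≡ 0 [mod 9] /\
       ~ coefA'1 p + 5%:R ≡ 3%:R * p`_2 * p`_0 + 3%:R * coefS5 p [mod 9])
    \/
    (coefD'0 p ≡ 0 [mod 3] /\ coefD'1 p ≡ 1 [mod 3] /\ p`_1 ≡ 1 [mod 3] /\
       ~ coefA'0 p + 6%:R ≡ 0 [mod 9] /\
       ~ coefA'0 p + 6%:R ≡ 6%:R * p`_2 * p`_0 + 3%:R * coefS2 p [mod 9])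
    \/
    (coefD'0 p ≡ 1 [mod 3] /\ coefD'1 p ≡ 0 [mod 3] /\ p`_1 ≡ 2%:R [mod 3] /\
       ~ coefA'1 p + 5%:R ≡ 0 [mod 9] /\
       ~ coefA'1 p + 5%:R ≡ 6%:R * p`_2 * p`_0 + 3%:R * coefS5 p [mod 9])
    \/
    (coefD'0 p ≡ 2%:R [mod 3] /\ coefD'1 p ≡ 0 [mod 3] /\ p`_1 ≡ 2%:R [mod 3] /\
       ~ coefA'0 p + 6%:R ≡ 0 [mod 9] /\
       ~ coefA'0 p + 6%:R ≡ 3%:R * p`_2 * p`_0 + 3%:R * coefS2 p [mod 9])).
Proof.
move=> A0 A1; rewrite (growth_conditions p α β A0 A1) /=.
have e0 : 0 = 3%:R * 0 :> Z3 by ring.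
have A05 : coefA'0 p + 6%:R = 3%:R * (α + 2%:R) by rewrite A0; ring.
have A15 : coefA'1 p + 5%:R = 3%:R * (β + 2%:R) by rewrite A1; ring.
have r1 : 3%:R * p`_2 * p`_0 + 3%:R * coefS5 p = 3%:R * (p`_2 * p`_0 + coefS5 p).
  by ring.
have r2 : 6%:R * p`_2 * p`_0 + 3%:R * coefS2 p =
    3%:R * (2%:R * (p`_2 * p`_0) + coefS2 p) by ring.
have r3 : 6%:R * p`_2 * p`_0 + 3%:R * coefS5 p =
    3%:R * (2%:R * (p`_2 * p`_0) + coefS5 p) by ring.
have r4 : 3%:R * p`_2 * p`_0 + 3%:R * coefS2 p = 3%:R * (p`_2 * p`_0 + coefS2 p).
  by ring.
rewrite A05 A15 r1 r2 r3 r4.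
have z9 x : 3%:R * x ≡ 0 [mod 9] <-> red3 x = 0.
  by rewrite {1}e0 eqmod9_mul3 rmorph0.
rewrite !red3_eq !z9 !eqmod9_mul3.
have red_double x : red3 (2%:R * x) = 2 * red3 x by rewrite rmorphM rmorph_nat.
have red_2 : red3 2%:R = 2 by rewrite rmorph_nat.
have redDn (x y : Z3) : red3 (x + y) = red3 x + red3 y by rewrite rmorphD.
by rewrite !(red_double, red_2) !redDn !(red_double, red_2, rmorph0, rmorph1).
Qed.

Theorem corollary19 (p : {poly Z3}) :
  minimal_system (fun x : Z3 => p.[x]) <->
  (~ p`_0 ≡ 0 [mod 3] /\
   coefA'0 p ≡ 0 [mod 3] /\
   coefA'1 p ≡ 1 [mod 3] /\
   ((coefD'0 p ≡ 0 [mod 3] /\ coefD'1 p ≡ 2%:R [mod 3] /\ p`_1 ≡ 1 [mod 3] /\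
       ~ coefA'1 p + 5%:R ≡ 0 [mod 9] /\
       ~ coefA'1 p + 5%:R ≡ 3%:R * p`_2 * p`_0 + 3%:R * coefS5 p [mod 9])
    \/
    (coefD'0 p ≡ 0 [mod 3] /\ coefD'1 p ≡ 1 [mod 3] /\ p`_1 ≡ 1 [mod 3] /\
       ~ coefA'0 p + 6%:R ≡ 0 [mod 9] /\
       ~ coefA'0 p + 6%:R ≡ 6%:R * p`_2 * p`_0 + 3%:R * coefS2 p [mod 9])
    \/
    (coefD'0 p ≡ 1 [mod 3] /\ coefD'1 p ≡ 0 [mod 3] /\ p`_1 ≡ 2%:R [mod 3] /\
       ~ coefA'1 p + 5%:R ≡ 0 [mod 9] /\
       ~ coefA'1 p + 5%:R ≡ 6%:R * p`_2 * p`_0 + 3%:R * coefS5 p [mod 9])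
    \/
    (coefD'0 p ≡ 2%:R [mod 3] /\ coefD'1 p ≡ 0 [mod 3] /\ p`_1 ≡ 2%:R [mod 3] /\
       ~ coefA'0 p + 6%:R ≡ 0 [mod 9] /\
       ~ coefA'0 p + 6%:R ≡ 3%:R * p`_2 * p`_0 + 3%:R * coefS2 p [mod 9]))).

Proof.
rewrite minimal_normalized; split=> -[p0].
  move=> growth; have [b [cube0 _ _ _]] := growth.
  (* The 3-cycle modulo 3 alone fixes A'0 and A'1 modulo 3, which supplies the α and β of the
     remaining conditions. *)
  have [|A0 A1] := cycle3_coefs p.
    by rewrite cube0 rmorphM /= red3_3 mul0r.
  have {}A0 : coefA'0 p ≡ 0 [mod 3] by apply/red3_eq0.
  have {}A1 : coefA'1 p ≡ 1 [mod 3] by apply/red3_eq; rewrite A1 rmorph1.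
  have [[α A0E] [β A1E]] := ((Z3_eqmod0P _ _).1 A0, (Z3_eqmodP _ _ _).1 A1).
  by rewrite -(growth_conditions_mod9 p α β A0E A1E).
move=> [/Z3_eqmod0P[α A0] [/Z3_eqmodP[β A1] conds]]; split=> //.
by rewrite (growth_conditions_mod9 p α β A0 A1).
Qed.
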